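(* If a finite nilpotent group $G$ is unramified over an abelian normal subgroup $N$, then $G'\subsetneq N$, where $G'$ is the commutator subgroup of $G$. In particular, every totally unramified nilpotent group is metabelian.
   Context: All groups are finite, all representations are complex. A representation is multiplicity free if it is a direct sum of pairwise non-equivalent irreducible representations; a restriction $\rho|_N$ is called trivial if every element of $N$ acts as the identity. A finite group $G$ is unramified over a nontrivial abelian normal subgroup $N$ if for every irreducible representation $\rho$ of $G$ the restriction $\rho|_N$ is multiplicity free or trivial (so ''unramified over $N$'' includes that $N$ is nontrivial). A finite group $G$ is totally unramified (recursively) if it is abelian or there exists a nontrivial abelian normal subgroup $N$ such that $G$ is unramified over $N$ and $G/N$ is totally unramified. A group is metabelian if its commutator subgroup is abelian. *)

(* Defs.v *)
From mathcomp Require Import all_boot all_order all_fingroup all_algebra.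
From mathcomp Require Import all_solvable mxrepresentation.
From mathcomp Require Import reals complex.

Set Implicit Arguments.
Unset Strict Implicit.
Unset Printing Implicit Defensive.

Local Open Scope ring_scope.

(* A variant of the library's [mxsemisimple] for the whole space, in which the
   simple summands are moreover pairwise non-isomorphic. The index type may be
   empty, so the representation of degree 0 is multiplicity free. *)
Definition multiplicity_free (F : fieldType) (gT : finGroupType)
    (G : {group gT}) (n : nat) (rG : mx_representation F G n) : Prop :=
  exists (I : finType) (U : I -> 'M[F]_n),
    [/\ forall i, mxsimple rG (U i),
        (\sum_(i : I) U i :=: 1%:M)%MS,
        mxdirect (\sum_(i : I) U i)%MS
      & forall i j, mx_iso rG (U i) (U j) -> i = j].

Definition trivial_repr (F : fieldType) (gT : finGroupType)
    (G : {group gT}) (n : nat) (rG : mx_representation F G n) : Prop :=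
  forall x, x \in G -> rG x = 1%:M.

Definition unramified (F : fieldType) (gT : finGroupType)
    (G N : {group gT}) : Prop :=
  [/\ N :!=: 1%g, abelian N &
      exists nsNG : (N <| G)%g,
        forall (n : nat) (rG : mx_representation F G n),
          mx_irreducible rG ->
          let rN := subg_repr rG (normal_sub nsNG) in
          multiplicity_free rN \/ trivial_repr rN].

Inductive totally_unramified (F : fieldType) :
    forall gT : finGroupType, {group gT} -> Prop :=
| TotallyUnramifiedAbelian (gT : finGroupType) (G : {group gT}) :
    abelian G -> totally_unramified F G
| TotallyUnramifiedStep (gT : finGroupType) (G N : {group gT}) :
    unramified F G N -> totally_unramified F (G / N)%G ->
    totally_unramified F G.

Definition metabelian (gT : finGroupType) (G : {group gT}) : Prop :=
  abelian G^`(1)%g.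

(* Main.v *)
Require Import Defs.
From mathcomp Require Import all_boot all_order all_fingroup all_algebra.
From mathcomp Require Import all_solvable mxrepresentation reals complex.

(** Put K = [G, N], a proper subgroup of N because G is nilpotent, and let rG be
    an irreducible representation of G / K that is nontrivial on N. As N / K is
    central, Schur's lemma makes N act by scalars, and such an action is
    multiplicity free only in degree 1; so rG is a linear character chi. If
    sG is an irreducible representation of G / K that is trivial on N, then
    chi * sG is irreducible and nontrivial on N, hence of degree 1 as well.
    Thus all the irreducible representations of G / K are linear, G / K is
    abelian, and G' is contained in K. *)

Set Implicit Arguments.
Unset Strict Implicit.
Unset Printing Implicit Defensive.

Import GroupScope GRing.Theory Num.Theory.
Local Open Scope ring_scope.

(** The regular representation is faithful and, by Maschke's theorem, a sum of simple submodules;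
    [x] acts trivially on each of them, hence on the whole. *)
Lemma irr_repr_separate (F : fieldType) (gT : finGroupType) (G : {group gT}) x :
    [pchar F]^'.-group G -> x \in G ->
    (forall n (rG : mx_representation F G n),
       mx_irreducible rG -> x \in rker rG) ->
  x = 1%g.
Proof.
move=> F'G Gx triv; pose aG := regular_repr F G.
have redG : mx_completely_reducible aG 1%:M := mx_Maschke_pchar aG F'G.
(* The decomposition into simples is only available classically, so the goal is first made
   boolean. *)
apply/eqP; apply: (mx_reducible_semisimple (mxmodule1 aG) redG).
case=> I U /= simU defU _; suffices: x \in rker aG.
  by move/(subsetP (regular_mx_faithful F G)); rewrite inE.
rewrite inE Gx mul1mx; apply/eqP; rewrite -[LHS]mul1mx.
have /sub_sumsmxP[u ->] : (1%:M <= \sum_(i : I) U i)%MS by rewrite defU.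
rewrite mulmx_suml; apply: eq_bigr => i _.
have [modU _ _] := simU i; rewrite -mulmxA; congr (_ *m _).
have := triv _ _ (proj2 (submod_mx_irr modU) (simU i)).
by rewrite rker_submod inE => /andP[_ /eqP].
Qed.

Lemma irr_repr_separate_quotient (F : fieldType) (gT : finGroupType)
    (G K : {group gT}) x :
    [pchar F]^'.-group G -> K <| G -> x \in G ->
    (forall n (rG : mx_representation F G n),
       mx_irreducible rG -> K \subset rker rG -> x \in rker rG) ->
  x \in K.
Proof.
move=> F'G /andP[sKG nKG] Gx triv; apply: coset_idr (subsetP nKG x Gx) _.
apply: (@irr_repr_separate F (coset_of K) (G / K)%G); first exact: quotient_pgroup.
  exact: mem_quotient.
move=> n rG irrG; pose sG := morphim_repr rG nKG.
have: x \in rker sG.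
  apply: triv; first exact/morphim_mx_irr.
  rewrite rker_morphim subsetI sKG -sub_morphim_pre ?normG //.
  by rewrite -[coset K @* K]/(K / K)%g trivg_quotient sub1G.
by rewrite rker_morphim => /setIP[_ /morphpreP[]].
Qed.

(** Under a scalar action every subspace is a submodule and every linear map a homomorphism. The
    simple summands are thus lines, all isomorphic, so there is at most one. *)
Lemma scalar_multiplicity_free_degree (F : fieldType) (gT : finGroupType)
    (G : {group gT}) n (rG : mx_representation F G n) :
    (forall x, x \in G -> is_scalar_mx (rG x)) -> multiplicity_free rG ->
  (n <= 1)%N.
Proof.
move=> scalG [I [U [simU defU dxU isoU]]].
have modG m (V : 'M_(m, n)) : mxmodule rG V.
  apply/mxmoduleP=> x /scalG/is_scalar_mxP[a ->].
  by rewrite mul_mx_scalar scalemx_sub.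
have homG f (V : 'M_n) : (V <= dom_hom_mx rG f)%MS.
  suff cf : centgmx rG f by exact: centgmx_hom.
  by apply/centgmxP=> x /scalG/is_scalar_mxP[a ->]; apply: scalar_mxC.
(* By minimality, [U i] is the line spanned by any nonzero row in it. *)
have defUi i : (U i :=: nz_row (U i))%MS.
  have [_ nzU minU] := simU i; apply/eqmxP; rewrite nz_row_sub andbT.
  rewrite -(genmxE (nz_row _)) minU ?genmxE ?nz_row_sub //.
  by rewrite -mxrank_eq0 genmxE mxrank_eq0 nz_row_eq0.
have nzUi i : nz_row (U i) != 0 by rewrite nz_row_eq0; case: (simU i).
have eqI (i j : I) : i = j.
  (* [f] sends the chosen generator of [U i] to that of [U j]. *)
  apply: isoU; pose f := pinvmx (nz_row (U i)) *m nz_row (U j).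
  have fE : nz_row (U i) *m f = nz_row (U j).
    by rewrite mulmxA mulmxVp ?mul1mx // /row_free rank_rV nzUi.
  have defUf : (U i *m f :=: U j)%MS.
    by apply: eqmx_trans (eqmxMr f (defUi i)) _; rewrite fE; apply: eqmx_sym.
  apply: (mx_Schur_iso (simU i) (simU j) (homG f _)); first by rewrite defUf.
  by case: (simU j) => _ nzUj _; rewrite -!mxrank_eq0 defUf mxrank_eq0.
have <- : \rank (\sum_i U i)%MS = n by rewrite defU mxrank1.
rewrite (mxdirectP dxU) /=.
rewrite (eq_bigr (fun=> 1%N)) => [|i _]; last by rewrite defUi rank_rV nzUi.
by rewrite sum1_card; apply/card_le1P=> i _ j; rewrite !inE; apply/esym/eqP.
Qed.

Section Twist.

Variables (F : fieldType) (gT : finGroupType) (G : {group gT}) (n : nat).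
Variables (chi : mx_representation F G 1) (rG : mx_representation F G n).

(** The tensor product of [chi] and [rG], written as a scalar multiple so that the degree stays
    [n]. *)
Definition twist_mx (x : gT) : 'M[F]_n := chi x 0 0 *: rG x.

Lemma twist_mx_repr : mx_repr G twist_mx.
Proof.
split=> [|x y Gx Gy]; rewrite /twist_mx.
  by rewrite !repr_mx1 mxE scale1r.
by rewrite !repr_mxM // mxE big_ord1 -scalemxAl -scalemxAr scalerA.
Qed.

Definition twist_repr := MxRepresentation twist_mx_repr.

Lemma twist_coef_neq0 x : x \in G -> chi x 0 0 != 0.
Proof.
move=> Gx; have: chi x \in unitmx by apply: repr_mx_unit.
by rewrite unitmxE det_mx11 unitfE.
Qed.

(** Multiplying by nonzero scalars does not change the invariant subspaces. *)
Lemma twist_mx_irr : mx_irreducible rG -> mx_irreducible twist_repr.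
Proof.
case/mx_irrP=> n_gt0 irrG; apply/mx_irrP; split=> // U modU.
apply: irrG; apply/mxmoduleP=> x Gx; move/mxmoduleP/(_ x Gx): modU.
by rewrite -scalemxAr (eqmx_scale _ (twist_coef_neq0 Gx)).
Qed.

End Twist.

Section ClosedField.

Variables (C : numClosedFieldType) (gT : finGroupType).
Implicit Types G N K : {group gT}.

(** For an eigenvalue [a] of [A], the matrix [A - a%:M] is singular and commutes with the action, so
    it vanishes by Schur's lemma. *)
Lemma irr_centgmx_scalar G n (rG : mx_representation C G n) (A : 'M_n) :
  mx_irreducible rG -> centgmx rG A -> is_scalar_mx A.
Proof.
move=> irrG cGA; have [n_gt0 _] := proj1 (mx_irrP rG) irrG.
have [a /eigenvalueP[v vA nz_v]] := eigenvalue_closed A n_gt0.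
have cGAa : centgmx rG (A - a%:M).
  apply/centgmxP=> x Gx; rewrite mulmxBl mulmxBr (centgmxP cGA) //.
  by rewrite scalar_mxC.
apply/is_scalar_mxP; exists a; apply/eqP; rewrite -subr_eq0.
apply: contraR nz_v => /(mx_Schur irrG cGAa) uAa.
by rewrite -[v](mulmxK uAa) mulmxBr vA mul_mx_scalar subrr mul0mx.
Qed.

Lemma unramified_irr_degree G N n (rG : mx_representation C G n) :
    unramified C G N -> mx_irreducible rG -> [~: G, N] \subset rker rG ->
  ~~ (N \subset rker rG) -> n = 1%N.
Proof.
case=> _ _ [nsNG unrG] irrG kerK ntN.
have [sNG _] := andP nsNG.
have [n_gt0 _] := proj1 (mx_irrP rG) irrG.
apply/eqP; rewrite eqn_leq n_gt0 andbT.
case: (unrG n rG irrG) => [mfN | trivN]; last first.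
  case/negP: ntN; apply/subsetP=> z Nz; apply/rkerP.
  by split; [apply: (subsetP sNG) | apply: trivN].
apply: scalar_multiplicity_free_degree mfN => z Nz.
have Gz := subsetP sNG z Nz.
apply: (irr_centgmx_scalar irrG); apply/centgmxP=> x Gx /=.
have /rkerP[_ kxz] := subsetP kerK _ (mem_commg Gx Nz).
(* Here x z = z x [x, z], and the commutator acts as the identity. *)
by rewrite -!repr_mxM // [in RHS]commgC (repr_mxM _ (groupM Gz Gx)) ?groupR //
  kxz mulmx1.
Qed.

Lemma unramified_der1_sub_commg G N :
  nilpotent G -> unramified C G N -> (G^`(1) \subset [~: G, N])%g.
Proof.
move=> nilG unrG; have [ntN _ [/andP[sNG nNG] _]] := unrG.
have C'G : [pchar C]^'.-group G.
  by apply/pgroupP=> p _ _; rewrite inE /= pchar_num.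
have nsKG : [~: G, N]%G <| G.
  by rewrite /normal comm_subG //= commg_norml.
have [z Nz notKz] : exists2 z, z \in N & z \notin [~: G, N].
  apply/subsetPn; apply: proper_subn.
  by apply: (nil_comm_properr nilG) => //; rewrite subsetI subxx.
apply/subsetP=> y G'y; apply: contraR notKz => notKy.
have Gz := subsetP sNG z Nz.
(* If [y] is outside K, then [z] must be in K: an irreducible [rG] trivial on K but not at [z] is
   the linear character chi, and its existence forces [y] into K. *)
apply: (irr_repr_separate_quotient C'G nsKG Gz) => n rG irrG kerK.
apply: contraR notKy => notKz.
have ntN' : ~~ (N \subset rker rG) by apply/subsetPn; exists z.
have n1 := unramified_irr_degree unrG irrG kerK ntN'.
subst n; apply: (irr_repr_separate_quotient C'G nsKG) => [|m sG irrsG kerKs].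
  exact: subsetP (der_sub 1 G) y G'y.
suffices m1 : m = 1%N by apply: subsetP (rker_linear sG m1) y G'y.
have [trivN | ntNs] := boolP (N \subset rker sG); last first.
  exact: unramified_irr_degree unrG irrsG kerKs ntNs.
apply: unramified_irr_degree unrG (twist_mx_irr rG irrsG) _ _.
  apply/subsetP=> k Kk; have /rkerP[Gk rGk] := subsetP kerK k Kk.
  have /rkerP[_ sGk] := subsetP kerKs k Kk.
  by apply/rkerP; rewrite /= /twist_mx rGk sGk mxE scale1r.
apply/subsetPn; exists z => //; apply: contra notKz => /rkerP[_].
have /rkerP[_ sGz] := subsetP trivN z Nz.
(* As [sG] is trivial at [z], the twist acts there as the scalar chi(z); any diagonal entry recovers
   chi(z) = 1, contradicting the choice of [rG]. *)
have [m_gt0 _] := proj1 (mx_irrP sG) irrsG; pose i0 := Ordinal m_gt0.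
rewrite /= /twist_mx sGz => /matrixP/(_ i0 i0); rewrite !mxE eqxx mulr1 => chiz.
by apply/rkerP; split=> //; rewrite [rG z]mx11_scalar chiz.
Qed.

Lemma unramified_der1_proper G N :
  nilpotent G -> unramified C G N -> (G^`(1) \proper N)%g.
Proof.
move=> nilG unrG; have [ntN _ [/andP[sNG nNG] _]] := unrG.
apply: sub_proper_trans (unramified_der1_sub_commg nilG unrG) _.
by apply: (nil_comm_properr nilG) => //; rewrite subsetI subxx.
Qed.

End ClosedField.

Theorem theorem6p4 (R : realType) :
  (forall (gT : finGroupType) (G N : {group gT}),
     nilpotent G -> unramified R[i] G N -> (G^`(1) \proper N)%g)
  /\
  (forall (gT : finGroupType) (G : {group gT}),
     nilpotent G -> totally_unramified R[i] G -> metabelian G).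
Proof.
split=> [gT G N | gT G nilG unrG]; first exact: unramified_der1_proper.
case: gT G / unrG nilG => [gT G abG | gT G N unrG _] nilG.
  exact: abelianS (der_sub 1 G) abG.
have [_ abN _] := unrG; apply: abelianS abN.
exact: proper_sub (unramified_der1_proper nilG unrG).
Qed.
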